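(* Let $\mathcal{R}_4=(\mathcal{T},X_{\mathcal{T}},f_{\mathcal{T}})$ be the relative structure on the isomorphism classes of $n$-filtrations in which $\mathcal{T}$ consists of all topological spaces; for $T\in\mathcal{T}$, $X_T$ is the set of pairs $(T,g)$ with $g:T\to\mathbb{R}^n$ a function, $d_T((T,g_1),(T,g_2))=\sup_{x\in T}\|g_1(x)-g_2(x)\|_\infty$, and $f_T(T,g)=F^S(T,g)$. Then the strong interleaving distance $d_{SI}$ is $\mathcal{R}_4$-optimal.
   Context: $\mathbb{R}^n$ carries the product partial order. An $n$-filtration $X$ is a collection of topological spaces $\{X_a\}_{a\in\mathbb{R}^n}$ with continuous maps $\phi_X(a,b):X_a\to X_b$ for $a\le b$ such that $\phi_X(b,c)\circ\phi_X(a,b)=\phi_X(a,c)$ for $a\le b\le c$ (and $\phi_X(a,a)=\mathrm{id}$). A morphism $f:X\to Y$ is a collection of continuous maps $f_a:X_a\to Y_a$ commuting with the transition maps. For $\epsilon\ge0$, $\vec\epsilon=(\epsilon,\dots,\epsilon)$, $X(\epsilon)$ is the $n$-filtration with $X(\epsilon)_a=X_{a+\vec\epsilon}$ and $\phi_{X(\epsilon)}(a,b)=\phi_X(a+\vec\epsilon,b+\vec\epsilon)$; $f(\epsilon)_a=f_{a+\vec\epsilon}$; $S(X,\epsilon):X\to X(\epsilon)$ has $S(X,\epsilon)_a=\phi_X(a,a+\vec\epsilon)$. Two $n$-filtrations $X,Y$ are strongly $\epsilon$-interleaved if there are morphisms $f:X\to Y(\epsilon)$, $g:Y\to X(\epsilon)$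 with $g(\epsilon)\circ f=S(X,2\epsilon)$ and $f(\epsilon)\circ g=S(Y,2\epsilon)$. $d_{SI}(X,Y)=\inf\{\epsilon\ge0: X,Y\text{ are strongly }\epsilon\text{-interleaved}\}\in[0,\infty]$. For a function $g:T\to\mathbb{R}^n$ on a topological space (not necessarily continuous), $F^S(T,g)$ is the $n$-filtration with $F^S(T,g)_a=\{x\in T: g(x)\le a\}$ (subspace topology) and inclusions as transition maps. A relative structure on a set (or class) $Y$ is a triple $\mathcal{R}=(\mathcal{T},X_{\mathcal{T}},f_{\mathcal{T}})$ with $\mathcal{T}$ an index set (or class), $X_{\mathcal{T}}=\{(X_s,d_s)\}_{s\in\mathcal{T}}$ pseudometric spaces and $f_{\mathcal{T}}=\{f_s:X_s\to Y\}_{s\in\mathcal{T}}$ functions; $\mathrm{im}(f_{\mathcal{T}})=\bigcup_s\mathrm{im}(f_s)$. Pseudometrics take values in $[0,\infty]$. A pseudometric $d$ on $Y$ is $\mathcal{R}$-stable if $d(f_s(x_1),f_s(x_2))\le d_s(x_1,x_2)$ for all $s\in\mathcal{T}$, $x_1,x_2\in X_s$. It is $\mathcal{R}$-optimal if it is $\mathcal{R}$-stable and every $\mathcal{R}$-stable pseudometric $d'$ on $Y$ satisfies $d'(y_1,y_2)\le d(y_1,y_2)$ for all $y_1,y_2\in\mathrm{im}(f_{\mathcal{T}})$. *)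

(* Defs.v *)
From mathcomp Require Import all_boot all_order all_algebra.
From mathcomp Require Import all_classical reals interval_inference ereal.
From mathcomp Require Import topology normedtype.

Set Implicit Arguments.
Unset Strict Implicit.
Unset Printing Implicit Defensive.

Import Order.TTheory GRing.Theory Num.Theory.
Import numFieldNormedType.Exports.

Local Open Scope classical_set_scope.
Local Open Scope ring_scope.

Section ProductOrder.
Context {R : realType} {n : nat}.
Implicit Types (a b c : 'rV[R]_n) (e : {nonneg R}).

Definition vle a b : Prop := forall i, a ord0 i <= b ord0 i.

Definition vshift a e : 'rV[R]_n := a + const_mx e%:num.

Lemma vle_refl a : vle a a.
Proof. by move=> i. Qed.

Lemma vle_trans b a c : vle a b -> vle b c -> vle a c.
Proof. by move=> ab bc i; exact: le_trans (ab i) (bc i). Qed.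

Lemma vshift_mono a b e : vle a b -> vle (vshift a e) (vshift b e).
Proof. by move=> ab i; rewrite !mxE lerD2r. Qed.

Lemma vle_vshift a e : vle a (vshift a e).
Proof. by move=> i; rewrite !mxE lerDl. Qed.

Lemma vle_vshift_vshift a e : vle a (vshift (vshift a e) e).
Proof. exact: vle_trans (vle_vshift a e) (vle_vshift _ e). Qed.

End ProductOrder.

Record nfiltration (R : realType) (n : nat) := NFiltration {
  space :> 'rV[R]_n -> topologicalType;
  transition : forall a b, vle a b -> space a -> space b;
  transition_continuous : forall a b (ab : vle a b),
    continuous (transition ab);
  transition_id : forall a (aa : vle a a), transition aa =1 id;
  transition_comp : forall a b c (ab : vle a b) (bc : vle b c) (ac : vle a c),
    transition bc \o transition ab =1 transition ac }.

Arguments transition {R n} X [a b] ab : rename.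
Arguments transition_continuous {R n} X [a b] ab : rename.

Record filt_mor (R : realType) (n : nat) (X Y : nfiltration R n) := FiltMor {
  mor_fun :> forall a, X a -> Y a;
  mor_continuous : forall a, continuous (@mor_fun a);
  mor_natural : forall a b (ab : vle a b),
    @mor_fun b \o transition X ab =1 transition Y ab \o @mor_fun a }.

Arguments mor_fun {R n X Y} f a : rename.
Arguments mor_continuous {R n X Y} f a : rename.

Section Morphisms.
Context {R : realType} {n : nat}.
Implicit Types (X Y Z : nfiltration R n) (e : {nonneg R}).

Lemma continuousT_comp (A B C : topologicalType) (f : A -> B) (g : B -> C) :
  continuous f -> continuous g -> continuous (g \o f).
Proof. by move=> cf cg x; apply: continuous_comp; [exact: cf|exact: cg]. Qed.
Arguments continuousT_comp {A B C f g} cf cg : rename.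

Definition mor_id X : filt_mor X X.
Proof. by exists (fun _ => id) => // a x; exact: cvg_id. Defined.

Definition mor_comp X Y Z (g : filt_mor Y Z) (f : filt_mor X Y) :
  filt_mor X Z.
Proof.
exists (fun a => g a \o f a) => [a|a b ab x].
  exact: continuousT_comp (mor_continuous f a) (mor_continuous g a).
by have /= -> := mor_natural f ab x; have /= -> := mor_natural g ab (f a x).
Defined.

Definition isomorphic X Y : Prop :=
  exists (f : filt_mor X Y) (g : filt_mor Y X),
    (forall a, mor_comp g f a =1 mor_id X a) /\
    (forall a, mor_comp f g a =1 mor_id Y a).

Definition shift X e : nfiltration R n.
Proof.
exists (fun a => X (vshift a e))
       (fun a b ab => transition X (vshift_mono e ab)).
- by move=> a b ab; exact: transition_continuous.
- by move=> a aa; exact: transition_id.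
- by move=> a b c ab bc ac; exact: transition_comp.
Defined.

Definition mor_shift X Y (f : filt_mor X Y) e :
  filt_mor (shift X e) (shift Y e).
Proof.
exists (fun a => f (vshift a e)) => [a|a b ab].
  exact: (mor_continuous f (vshift a e)).
exact: (mor_natural f (vshift_mono e ab)).
Defined.

(* S(X, 2e), with codomain presented as X(e)(e) rather than X(2e): the indices
   (a + e) + e and a + 2e are equal but not convertible. *)
Definition smoothing2 X e : filt_mor X (shift (shift X e) e).
Proof.
exists (fun a => transition X (vle_vshift_vshift a e)) => [a|a b ab x].
  exact: transition_continuous.
have ac : vle a (vshift (vshift b e) e) by exact/(vle_trans ab)/vle_vshift_vshift.
by rewrite (transition_comp _ _ ac) [RHS](transition_comp _ _ ac).
Defined.

Definition strongly_interleaved e X Y : Prop :=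
  exists (f : filt_mor X (shift Y e)) (g : filt_mor Y (shift X e)),
    (forall a, mor_comp (mor_shift g e) f a =1 smoothing2 X e a) /\
    (forall a, mor_comp (mor_shift f e) g a =1 smoothing2 Y e a).

Definition dSI X Y : \bar R :=
  ereal_inf [set e%:num%:E | e in [set e | strongly_interleaved e X Y]].

Lemma isomorphic_refl X : isomorphic X X.
Proof. by exists (mor_id X), (mor_id X). Qed.

Lemma isomorphic_sym X Y : isomorphic X Y -> isomorphic Y X.
Proof. by move=> [f [g [fg gf]]]; exists g, f. Qed.

Lemma isomorphic_trans Y X Z :
  isomorphic X Y -> isomorphic Y Z -> isomorphic X Z.
Proof.
move=> [f [g [gf fg]]] [h [k [kh hk]]].
exists (mor_comp h f), (mor_comp g k); split=> a x /=.
  by have /= -> := kh a (f a x); exact: gf.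
by have /= -> := fg a (k a x); exact: hk.
Qed.

Lemma strongly_interleaved_iso e X X' Y Y' :
  isomorphic X X' -> isomorphic Y Y' ->
  strongly_interleaved e X Y -> strongly_interleaved e X' Y'.
Proof.
move=> [p [q [qp pq]]] [r [s [sr rs]]] [f [g [gf fg]]].
exists (mor_comp (mor_shift r e) (mor_comp f q)).
exists (mor_comp (mor_shift p e) (mor_comp g s)).
split=> a x /=.
  have /= -> := sr _ (f a (q a x)).
  have /= -> := gf a (q a x).
  have /= -> := mor_natural p (vle_vshift_vshift a e) (q a x).
  by have /= -> := pq a x.
have /= -> := qp _ (g a (s a x)).
have /= -> := fg a (s a x).
have /= -> := mor_natural r (vle_vshift_vshift a e) (s a x).
by have /= -> := rs a x.
Qed.

Lemma dSI_iso X X' Y Y' :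
  isomorphic X X' -> isomorphic Y Y' -> dSI X Y = dSI X' Y'.
Proof.
move=> XX' YY'; rewrite /dSI; congr (ereal_inf (image _ _)).
apply/seteqP; split=> e; first exact: strongly_interleaved_iso.
by apply: strongly_interleaved_iso; exact: isomorphic_sym.
Qed.

End Morphisms.

(* A plain predicate and not a [set]: [nfiltration] lives above the universe of
   [set]. *)
Record iso_class (R : realType) (n : nat) := IsoClass {
  members : nfiltration R n -> Prop;
  membersP : exists X, members = isomorphic X }.

Section IsoClasses.
Context {R : realType} {n : nat}.
Implicit Types (X Y : nfiltration R n) (c : iso_class R n).

Definition class_of X : iso_class R n :=
  IsoClass (ex_intro (fun Y => isomorphic X = isomorphic Y) X erefl).

Definition class_repr c : nfiltration R n := projT1 (cid (membersP c)).

Definition class_dSI c1 c2 : \bar R := dSI (class_repr c1) (class_repr c2).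

Lemma class_of_eq X Y : class_of X = class_of Y <-> isomorphic X Y.
Proof.
split=> [/(congr1 (@members R n))/= ->|XY]; first exact: isomorphic_refl.
have eXY : isomorphic X = isomorphic Y.
  apply/funext => Z; apply/propext; split; last exact: isomorphic_trans.
  by apply: isomorphic_trans; exact: isomorphic_sym.
rewrite /class_of; move: (ex_intro _ X _) (ex_intro _ Y _).
by rewrite eXY => p q; rewrite (Prop_irrelevance p q).
Qed.

Lemma class_reprK c : class_of (class_repr c) = c.
Proof.
rewrite /class_repr; case: cid => X /=; case: c => m mP /= mX; subst m.
by rewrite /class_of; congr IsoClass; exact: Prop_irrelevance.
Qed.

Lemma class_dSIE X Y : class_dSI (class_of X) (class_of Y) = dSI X Y.
Proof. by apply: dSI_iso; apply/class_of_eq; rewrite class_reprK. Qed.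

End IsoClasses.

Section Sublevel.
Context {R : realType} {n : nat} (T : topologicalType).
Implicit Types (g : T -> 'rV[R]_n).

Definition sublevel_set g (a : 'rV[R]_n) : set T := [set x | vle (g x) a].

Lemma sublevel_set_sub g a b : vle a b -> sublevel_set g a `<=` sublevel_set g b.
Proof. by move=> ab x xa; exact: vle_trans xa ab. Qed.

Lemma subfun_continuous (A B : set T) (AB : A `<=` B) :
  continuous (subfun AB).
Proof. by apply: continuous_comp_initial; exact: initial_continuous. Qed.

Definition sublevel g : nfiltration R n.
Proof.
exists (fun a => set_type (sublevel_set g a))
       (fun a b ab => subfun (sublevel_set_sub (g := g) ab)).
- by move=> a b ab; exact: subfun_continuous.
- by move=> a aa x; exact: val_inj.
- by move=> a b c ab bc ac x; exact: val_inj.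
Defined.

(* The maximum with 0 only matters when T is empty, where [ereal_sup] of the
   empty set is -oo; the norm on ['rV[R]_n] is the sup norm. *)
Definition sup_dist g1 g2 : \bar R :=
  maxe 0%E (ereal_sup [set `|g1 x - g2 x|%:E | x in [set: T]]).

End Sublevel.

Record is_pseudometric (R : realType) (Y : Type) (d : Y -> Y -> \bar R) :
    Prop := IsPseudometric {
  pm_ge0 : forall x y, (0 <= d x y)%E;
  pm_refl : forall x, d x x = 0%E;
  pm_sym : forall x y, d x y = d y x;
  pm_triangle : forall x y z, (d x z <= d x y + d y z)%E }.

Record relative_structure (R : realType) (Y : Type) := RelativeStructure {
  rs_index : Type;
  rs_space : rs_index -> Type;
  rs_dist : forall s, rs_space s -> rs_space s -> \bar R;
  rs_distP : forall s, is_pseudometric (@rs_dist s);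
  rs_map : forall s, rs_space s -> Y }.

Section Optimality.
Context {R : realType} {Y : Type} (rs : relative_structure R Y).
Implicit Types d : Y -> Y -> \bar R.

Definition rs_im (y : Y) : Prop :=
  exists (s : rs_index rs) (x : rs_space s), rs_map x = y.

Definition rs_stable d : Prop :=
  is_pseudometric d /\
  forall (s : rs_index rs) (x1 x2 : rs_space s),
    (d (rs_map x1) (rs_map x2) <= rs_dist x1 x2)%E.

Definition rs_optimal d : Prop :=
  rs_stable d /\
  forall d', rs_stable d' ->
    forall y1 y2, rs_im y1 -> rs_im y2 -> (d' y1 y2 <= d y1 y2)%E.

End Optimality.

Section SublevelStructure.
Context (R : realType) (n : nat).

Lemma sup_dist_pseudometric (T : topologicalType) :
  is_pseudometric (@sup_dist R n T).
Proof.
split=> [g h|g|g h|g h k].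
- by rewrite /sup_dist le_max lexx.
- apply/max_idPl/ge_ereal_sup => _ [x _ <-].
  by rewrite subrr normr0.
- rewrite /sup_dist; congr (maxe _ (ereal_sup _)).
  by apply: eq_imagel => x _; rewrite distrC.
- have le_dist (f1 f2 : T -> 'rV[R]_n) x :
      (`|f1 x - f2 x|%:E <= sup_dist f1 f2)%E.
    by rewrite le_max; apply/orP; right; apply: ereal_sup_ubound; exists x.
  have dist_ge0 (f1 f2 : T -> 'rV[R]_n) : (0 <= sup_dist f1 f2)%E.
    by rewrite le_max lexx.
  rewrite {1}/sup_dist ge_max adde_ge0//=; apply: ge_ereal_sup => _ [x _ <-].
  apply: le_trans (leeD (le_dist g h x) (le_dist h k x)).
  by rewrite -EFinD lee_fin; exact: ler_distD.
Qed.

(* A pair (T, g) with first component T is represented by g alone. *)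
Definition sublevel_structure : relative_structure R (iso_class R n) :=
  @RelativeStructure R (iso_class R n)
    topologicalType
    (fun T => T -> 'rV[R]_n)
    (fun T => @sup_dist R n T)
    sup_dist_pseudometric
    (fun T g => class_of (sublevel g)).

End SublevelStructure.

(* Main.v *)
Require Import Defs.
From mathcomp Require Import all_boot all_order all_algebra.
From mathcomp Require Import all_classical reals interval_inference ereal.
From mathcomp Require Import topology normedtype.

(** The transition maps of a sublevel filtration are inclusions, so a strong
    [e]-interleaving of the filtrations of [g1 : T1 -> R^n] and [g2 : T2 -> R^n]
    glues to mutually inverse maps [F : T1 -> T2] and [G : T2 -> T1] of the
    underlying sets with [|g1 - g2 \o F| <= e].  [F] need not be continuous on
    [T1], but it is on each sublevel set of [g1], and [G] is on each sublevel set
    of [g2].  Since [{g2 \o F <= a}] lies in [{g1 <= a + e}], [F] restricts to a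
    homeomorphism from [{g2 \o F <= a}] to [{g2 <= a}].  Hence both filtrations
    are sublevel filtrations on the single space [T1], of functions at sup
    distance at most [e], and a stable pseudometric is at most [e] on them. *)

Set Implicit Arguments.
Unset Strict Implicit.
Unset Printing Implicit Defensive.

Import Order.TTheory GRing.Theory Num.Theory.
Import numFieldNormedType.Exports.
(* Again, because [normedtype] exports its own [shift]. *)
Import Defs.

Local Open Scope classical_set_scope.
Local Open Scope ring_scope.

(** * The strong interleaving distance as a pseudometric *)

Section StrongInterleavingDistance.
Context {R : realType} {n : nat}.
Implicit Types (X Y Z : nfiltration R n) (a b : 'rV[R]_n) (e : {nonneg R}).

Lemma transition_irr X a b (p q : vle a b) : transition X p =1 transition X q.
Proof. by rewrite (Prop_irrelevance p q). Qed.

Lemma transition_trans X a b c (ab : vle a b) (bc : vle b c) x :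
  transition X bc (transition X ab x) = transition X (vle_trans ab bc) x.
Proof. exact: (transition_comp (n := n)). Qed.

Definition smoothing X e : filt_mor X (shift X e).
Proof.
exists (fun a => transition X (vle_vshift a e)) => [a|a b ab x].
  exact: transition_continuous.
by rewrite /= !transition_trans; exact: transition_irr.
Defined.

Lemma strongly_interleaved_refl e X : strongly_interleaved e X X.
Proof.
exists (smoothing X e), (smoothing X e).
by split=> a x /=; rewrite !transition_trans; exact: transition_irr.
Qed.

Lemma strongly_interleaved_sym e X Y :
  strongly_interleaved e X Y -> strongly_interleaved e Y X.
Proof. by move=> [f [g [gf fg]]]; exists g, f. Qed.

Lemma vle_vshiftD a e1 e2 :
  vle (vshift (vshift a e1) e2) (vshift a (e1%:num + e2%:num)%:nng).
Proof. by move=> i; rewrite !mxE /= addrA. Qed.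

Lemma vle_vshiftDC a e1 e2 :
  vle (vshift (vshift a e2) e1) (vshift a (e1%:num + e2%:num)%:nng).
Proof. by move=> i; rewrite !mxE /= addrAC addrA. Qed.

(** The index [vshift (vshift a e1) e2] is not convertible to [vshift a e], so a transition map
    along [le_e] bridges the two in place of a type cast. Having [le_e] as a parameter lets both
    orders of [e1] and [e2] end at the same [e]. *)
Definition shift_comp X Y Z e1 e2 e
    (le_e : forall a, vle (vshift (vshift a e1) e2) (vshift a e))
    (f : filt_mor X (shift Y e1)) (h : filt_mor Y (shift Z e2)) :
  filt_mor X (shift Z e).
Proof.
exists (fun a => transition Z (le_e a) \o h (vshift a e1) \o f a).
  move=> a; apply: continuousT_comp (mor_continuous f a) _.
  apply: continuousT_comp (mor_continuous h _) _.
  exact: (transition_continuous Z (le_e a)).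
move=> a b ab x /=.
have /= -> := mor_natural f ab x.
have /= -> := mor_natural h (vshift_mono e1 ab) (f a x).
by rewrite !transition_trans; exact: transition_irr.
Defined.

(** Naturality moves [k], then [g], past the transition maps they are applied to, so that the two
    hypotheses collapse the composite to transition maps of [X]. *)
Lemma shift_compK X Y Z e1 e2 e
    (le12 : forall a, vle (vshift (vshift a e1) e2) (vshift a e))
    (le21 : forall a, vle (vshift (vshift a e2) e1) (vshift a e))
    (f : filt_mor X (shift Y e1)) (g : filt_mor Y (shift X e1))
    (h : filt_mor Y (shift Z e2)) (k : filt_mor Z (shift Y e2)) :
  (forall a, mor_comp (mor_shift g e1) f a =1 smoothing2 X e1 a) ->
  (forall a, mor_comp (mor_shift k e2) h a =1 smoothing2 Y e2 a) ->
  forall a, mor_comp (mor_shift (shift_comp le21 k g) e)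
                     (shift_comp le12 f h) a =1 smoothing2 X e a.
Proof.
move=> gf kh a x /=.
have /= -> := mor_natural k (le12 a) (h _ (f a x)).
have /= -> := kh _ (f a x).
rewrite transition_trans.
have /= -> := mor_natural g
  (vle_trans (vle_vshift_vshift _ e2) (vshift_mono e2 (le12 a))) (f a x).
have /= -> := gf a x.
by rewrite !transition_trans; exact: transition_irr.
Qed.

Lemma strongly_interleaved_trans Y X Z e1 e2 :
  strongly_interleaved e1 X Y -> strongly_interleaved e2 Y Z ->
  strongly_interleaved (e1%:num + e2%:num)%:nng X Z.
Proof.
move=> [f [g [gf fg]]] [h [k [kh hk]]].
exists (shift_comp (fun a => vle_vshiftD a e1 e2) f h).
exists (shift_comp (fun a => vle_vshiftDC a e1 e2) k g).
by split; exact: shift_compK.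
Qed.

Lemma dSI_le e X Y : strongly_interleaved e X Y -> (dSI X Y <= e%:num%:E)%E.
Proof. by move=> XY; apply: ge_ereal_inf; exists e%:num%:E => //; exists e. Qed.

Lemma le_dSI X Y (m : \bar R) :
  (forall e, strongly_interleaved e X Y -> (m <= e%:num%:E)%E) ->
  (m <= dSI X Y)%E.
Proof. by move=> le_m; apply: le_ereal_inf_tmp => _ [e /le_m me <-]. Qed.

Lemma dSI_ge0 X Y : (0 <= dSI X Y)%E.
Proof. by apply: le_dSI => e _; rewrite lee_fin. Qed.

Lemma dSI_triangle Y X Z : (dSI X Z <= dSI X Y + dSI Y Z)%E.
Proof.
have [XYfin|] := boolP (dSI X Y \is a fin_num); last first.
  by rewrite ge0_fin_numE ?dSI_ge0// ltey negbK => /eqP ->;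
    rewrite addye ?leey// gt_eqF// (lt_le_trans ltNy0) ?dSI_ge0.
have [YZfin|] := boolP (dSI Y Z \is a fin_num); last first.
  by rewrite ge0_fin_numE ?dSI_ge0// ltey negbK => /eqP ->;
    rewrite addey ?leey// gt_eqF// (lt_le_trans ltNy0) ?dSI_ge0.
(* Subtracting one finite summand at a time leaves a single infimum on the right, as [le_dSI]
   requires. *)
rewrite -leeBlDr//; apply: le_dSI => e1 XY; rewrite leeBlDr//.
rewrite addeC -leeBlDr//; apply: le_dSI => e2 YZ; rewrite leeBlDr//.
rewrite addeC -EFinD.
exact: (dSI_le (strongly_interleaved_trans XY YZ)).
Qed.

Lemma class_dSI_pseudometric : is_pseudometric (@class_dSI R n).
Proof.
split=> [x y|x|x y|x y z]; rewrite /class_dSI.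
- exact: dSI_ge0.
- apply/eqP; rewrite eq_le dSI_ge0 andbT.
  exact: (dSI_le (strongly_interleaved_refl 0%:nng _)).
- by rewrite /dSI; congr (ereal_inf (image _ _)); apply/seteqP; split=> e;
    exact: strongly_interleaved_sym.
- exact: dSI_triangle.
Qed.

End StrongInterleavingDistance.

(** * Sublevel filtrations: stability, gluing and a common domain *)

Section SublevelFiltrations.
Context {R : realType} {n : nat}.
Implicit Types (T : topologicalType) (e : {nonneg R}).

Lemma mx_norm_leP (v : 'rV[R]_n) e :
  reflect (forall i, `|v ord0 i| <= e%:num) (`|v| <= e%:num).
Proof.
rewrite [`|v|]mx_normrE; apply: (iffP idP) => [ve i|ve].
  by apply: le_trans ve; exact: (le_bigmax _ _ (ord0, i)).
(* The side condition closed by [//] bounds the default value 0 of the maximum, which is the whole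
   norm when [n = 0]. *)
by apply/bigmax_leP; split=> // -[i j] _; rewrite (ord1 i) ve.
Qed.

Lemma norm_vleP (v w : 'rV[R]_n) e :
  reflect (vle v (vshift w e) /\ vle w (vshift v e)) (`|v - w| <= e%:num).
Proof.
apply: (iffP (mx_norm_leP _ _)) => [vw|[vw wv] i].
  by split=> i; have := vw i; rewrite !mxE ler_norml lerBlDl lerNl opprB
    lerBlDl => /andP[].
by have := vw i; have := wv i;
  rewrite !mxE ler_norml [X in _ && X]lerBlDl lerNl opprB lerBlDl => -> ->.
Qed.

Lemma set_type_continuous (S : topologicalType) T (A : set T) (f : S -> A) :
  continuous (fun x => \val (f x)) -> continuous f.
Proof. exact: continuous_comp_initial. Qed.

Lemma val_continuous T (A : set T) : continuous (\val : A -> T).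
Proof. exact: initial_continuous. Qed.

Lemma sublevel_inj T (g : T -> 'rV[R]_n) a (u v : set_type (sublevel_set g a)) :
  \val u = \val v -> u = v :> sublevel g a.
Proof. exact: val_inj. Qed.

Lemma sublevel_set_shift T (g1 g2 : T -> 'rV[R]_n) e
    (le_g : forall x, vle (g2 x) (vshift (g1 x) e)) a :
  sublevel_set g1 a `<=` sublevel_set g2 (vshift a e).
Proof. by move=> x xa; apply: vle_trans (le_g x) _; exact: vshift_mono. Qed.

Definition sublevel_incl T (g1 g2 : T -> 'rV[R]_n) e
    (le_g : forall x, vle (g2 x) (vshift (g1 x) e)) :
  filt_mor (sublevel g1) (shift (sublevel g2) e).
Proof.
exists (fun a => subfun (sublevel_set_shift le_g (a := a))) => [a|a b ab x].
  exact: subfun_continuous.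
exact: sublevel_inj.
Defined.

(** All maps here are inclusions of subsets of [T], so the interleaving identities hold on
    underlying points. *)
Lemma sublevel_interleaved T (g1 g2 : T -> 'rV[R]_n) e :
  (forall x, `|g1 x - g2 x| <= e%:num) ->
  strongly_interleaved e (sublevel g1) (sublevel g2).
Proof.
move=> g12.
have le21 x : vle (g2 x) (vshift (g1 x) e) by case/norm_vleP: (g12 x).
have le12 x : vle (g1 x) (vshift (g2 x) e) by case/norm_vleP: (g12 x).
by exists (sublevel_incl le21), (sublevel_incl le12); split=> a x;
  exact: sublevel_inj.
Qed.

Lemma dSI_sublevel_le T (g1 g2 : T -> 'rV[R]_n) :
  (dSI (sublevel g1) (sublevel g2) <= sup_dist g1 g2)%E.
Proof.
have le_dist x : (`|g1 x - g2 x|%:E <= sup_dist g1 g2)%E.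
  by rewrite le_max; apply/orP; right; apply: ereal_sup_ubound; exists x.
have : (0 <= sup_dist g1 g2)%E by rewrite le_max lexx.
(* The maximum with 0 excludes -oo, the value +oo bounds everything, and a finite value is itself an
   admissible interleaving parameter. *)
case: (sup_dist g1 g2) le_dist => [r| |] le_dist //; last by rewrite !leey.
rewrite lee_fin => r0; apply: (@dSI_le _ _ (NngNum r0)).
by apply: sublevel_interleaved => x; rewrite -lee_fin.
Qed.

Section Glue.
Context (T1 T2 : topologicalType) (g1 : T1 -> 'rV[R]_n) (g2 : T2 -> 'rV[R]_n).
Context (e : {nonneg R}) (f : filt_mor (sublevel g1) (shift (sublevel g2) e)).

Lemma sublevel_memP T (g : T -> 'rV[R]_n) a (x : T) :
  vle (g x) a -> x \in sublevel_set g a.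
Proof. by move=> xa; exact: mem_set. Qed.

Definition sublevel_pt T (g : T -> 'rV[R]_n) a x (xa : vle (g x) a) :
  sublevel g a := SigSub (sublevel_memP xa).

(** The level [g1 x] is the least one whose sublevel set contains [x], so naturality carries the
    value of [f] there to every other such level. *)
Definition glue (x : T1) : T2 := \val (f (g1 x) (sublevel_pt (vle_refl (g1 x)))).

Lemma glueE a (u : sublevel g1 a) : glue (\val u) = \val (f a u).
Proof.
have ua : vle (g1 (\val u)) a := set_valP u.
have fN := mor_natural f ua (sublevel_pt (vle_refl _)).
apply: etrans (esym (congr1 \val fN)) _ => /=.
by congr (\val (f a _)); exact: sublevel_inj.
Qed.

Lemma glue_vle x : vle (g2 (glue x)) (vshift (g1 x) e).
Proof. exact: (set_valP (f (g1 x) _)). Qed.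

(** On a fixed sublevel set of [g1], [glue] is a single continuous component of [f]. The map [h]
    allows restriction to sublevel sets of other functions. *)
Lemma glue_continuous (S : topologicalType) a (h : S -> T1) :
  continuous h -> (forall s, vle (g1 (h s)) a) -> continuous (glue \o h).
Proof.
move=> hc ha.
have -> : glue \o h = \val \o (f a \o (fun s => sublevel_pt (ha s))).
  by apply/funext => s /=; rewrite -glueE.
apply: continuousT_comp; last exact: val_continuous.
apply: continuousT_comp (mor_continuous f a).
exact: set_type_continuous.
Qed.

End Glue.

(** The composite of [f] and the shifted [g] is a transition map, hence an inclusion, which fixes
    underlying points. *)
Lemma glueK T1 T2 (g1 : T1 -> 'rV[R]_n) (g2 : T2 -> 'rV[R]_n) e
    (f : filt_mor (sublevel g1) (shift (sublevel g2) e))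
    (g : filt_mor (sublevel g2) (shift (sublevel g1) e)) :
  (forall a, mor_comp (mor_shift g e) f a =1 smoothing2 (sublevel g1) e a) ->
  cancel (glue f) (glue g).
Proof.
by move=> gf x; rewrite [glue f x]/glue glueE; have /= -> := gf (g1 x) _.
Qed.

Lemma sublevel_interleaved_common T1 T2
    (g1 : T1 -> 'rV[R]_n) (g2 : T2 -> 'rV[R]_n) e :
  strongly_interleaved e (sublevel g1) (sublevel g2) ->
  exists h : T1 -> 'rV[R]_n, isomorphic (sublevel h) (sublevel g2) /\
    forall x, `|g1 x - h x| <= e%:num.
Proof.
move=> [f [g [gf fg]]].
have FK := glueK gf; have GK := glueK fg.
pose F := glue f; pose G := glue g; pose h := g2 \o F.
have le_hg x : vle (h x) (vshift (g1 x) e) := glue_vle f x.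
have le_gh x : vle (g1 x) (vshift (h x) e).
  by have := glue_vle g (F x); rewrite FK.
exists h; split; last by move=> x; apply/norm_vleP.
have Fin a (u : sublevel h a) : vle (g2 (F (\val u))) a := set_valP u.
have Gin a (u : sublevel g2 a) : vle (h (G (\val u))) a.
  by rewrite /h /= /F GK; exact: (set_valP u).
pose p a (u : sublevel h a) := sublevel_pt (Fin a u).
pose q a (u : sublevel g2 a) := sublevel_pt (Gin a u).
have pc a : continuous (@p a).
  (* The level [vshift a e] bounds [g1] on the sublevel set of [h] at [a]; for the inverse, [g2] is
     bounded by [a] itself. *)
  apply: set_type_continuous; apply: (@glue_continuous _ _ _ _ _ f _ (vshift a e)) => u /=.
    exact: val_continuous.
  by apply: vle_trans (le_gh _) _; exact/vshift_mono/Fin.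
have qc a : continuous (@q a).
  apply: set_type_continuous; apply: (@glue_continuous _ _ _ _ _ g _ a) => u /=.
    exact: val_continuous.
  exact: (set_valP u).
have pn a b (ab : vle a b) : @p b \o transition (sublevel h) ab
    =1 transition (sublevel g2) ab \o @p a by move=> u; exact: sublevel_inj.
have qn a b (ab : vle a b) : @q b \o transition (sublevel g2) ab
    =1 transition (sublevel h) ab \o @q a by move=> u; exact: sublevel_inj.
exists (FiltMor pc pn), (FiltMor qc qn).
by split=> a u; apply: sublevel_inj; [exact: FK|exact: GK].
Qed.

End SublevelFiltrations.

Theorem theorem3p2p10 (R : realType) (n : nat) :
  rs_optimal (sublevel_structure R n) (@class_dSI R n).
Proof.
split.
  split; first exact: class_dSI_pseudometric.
  by move=> T g1 g2; rewrite class_dSIE; exact: dSI_sublevel_le.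
move=> d [_ d_stable] _ _ [T1 [g1 <-]] [T2 [g2 <-]] /=.
rewrite class_dSIE; apply: le_dSI => e.
move=> /sublevel_interleaved_common[h [/class_of_eq <- g1h]].
(* Both [g1] and [h] have domain [T1], so they are points of one space of the relative structure and
   stability of [d] applies to them. *)
apply: le_trans (d_stable T1 g1 h) _.
rewrite /= /sup_dist ge_max lee_fin; apply/andP; split=> //.
by apply: ge_ereal_sup => _ [x _ <-]; rewrite lee_fin.
Qed.
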